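(* Let $A=(a_{ij})_{i,j=1,\dots,\ell}$ be a generalized Cartan matrix and let $\mathcal{D}$ be its Dynkin diagram. Then $A$ is symmetrizable if and only if each cycle in $\mathcal{D}$ is balanced.
   Context: A generalized Cartan matrix is an integer matrix $A=(a_{ij})_{i,j=1,\dots,\ell}$ with $a_{ii}=2$, $a_{ij}\le 0$ for $i\ne j$, and $a_{ij}=0$ implies $a_{ji}=0$. $A$ is symmetrizable if there exist nonzero rational numbers $d_1,\dots,d_\ell$ such that $DA$ is symmetric, where $D=\mathrm{diag}(d_1,\dots,d_\ell)$. The Dynkin diagram $\mathcal{D}$ of $A$ has vertices $v_1,\dots,v_\ell$; for $i\neq j$ the vertices $v_i,v_j$ are joined by an edge if and only if $a_{ij}\neq 0$ (equivalently $a_{ji}\ne 0$), and the edge is decorated so as to record the pair $(a_{ij},a_{ji})$. The multiplicity of the oriented edge $(v_i,v_j)$ is $mult(v_i,v_j)=a_{ji}/a_{ij}$. A cycle in $\mathcal{D}$ is a sequence $(v_{i_1},\dots,v_{i_k},v_{i_1})$ with $k\ge 3$, $v_{i_1},\dots,v_{i_k}$ distinct, and consecutive vertices (including $v_{i_k}$ and $v_{i_1}$) joined by an edge. The cycle is balanced if the product of the multiplicities of its oriented edges, when traversed in any particular direction, equals $1$, i.e. $mult(v_{i_1},v_{i_2})\,mult(v_{i_2},v_{i_3})\cdots mult(v_{i_k},v_{i_1})=1$. *)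

(* Defs.v *)
From mathcomp Require Import all_boot all_order all_algebra.

Set Implicit Arguments.
Unset Strict Implicit.
Unset Printing Implicit Defensive.

Import Order.TTheory GRing.Theory Num.Theory.
Local Open Scope ring_scope.

Definition generalized_Cartan (l : nat) (A : 'M[int]_l) : Prop :=
  [/\ forall i, A i i = 2,
      forall i j, i != j -> A i j <= 0
    & forall i j, A i j = 0 -> A j i = 0].

Definition symmetrizable (l : nat) (A : 'M[int]_l) : Prop :=
  exists2 d : 'rV[rat]_l,
    forall i, d 0 i != 0
  & let DA := diag_mx d *m map_mx intr A in DA^T = DA.

(* The decoration of a pair of vertices is meaningful only when they are
   joined by an edge. *)
Record diagram (V : finType) := Diagram {
  edge : rel V;
  decoration : V -> V -> int * int
}.

Definition Dynkin_diagram (l : nat) (A : 'M[int]_l) : diagram 'I_l :=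
  {| edge := fun i j => (i != j) && (A i j != 0);
     decoration := fun i j => (A i j, A j i) |}.

Definition mult (V : finType) (D : diagram V) (v w : V) : rat :=
  (decoration D v w).2%:Q / (decoration D v w).1%:Q.

(* The cycle (v_1, ..., v_k, v_1) is encoded by c = [:: v_1; ...; v_k];
   [ucycle] and [next] include the closing edge from v_k to v_1. *)
Definition is_cycle (V : finType) (D : diagram V) (c : seq V) : Prop :=
  (3 <= size c)%N /\ ucycle (edge D) c.

(* Only the direction in which c lists the vertices appears here; the reversed
   cycle is the sequence [rev c]. *)
Definition balanced (V : finType) (D : diagram V) (c : seq V) : Prop :=
  \prod_(v <- c) mult D v (next c v) = 1.

(* Main.v *)
Require Import Defs.
From mathcomp Require Import all_boot all_order all_algebra.

(** Symmetrizing [A] means finding nonzero [d] with [d_i a_ij = d_j a_ji] for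
    all [i, j]. This is automatic off the edges of the Dynkin diagram, and on an
    edge it says that the multiplicity [a_ji / a_ij] is the quotient
    [d_i / d_j]. So the question is whether the multiplicities, seen as a
    multiplicative 1-cochain on a graph, are the coboundary of a nowhere zero
    function on the vertices (a potential), and the theorem is the usual
    statement that this happens exactly when the cochain has trivial product
    around every cycle.

    If there is a potential, products along walks telescope
    ([walk_weight_potential]), hence closed ones are trivial.

    Conversely, suppose that simple cycles of length at least 3 have product 1.
    A closed walk that meets a vertex twice is cut there into two shorter closed
    walks, and a closed walk of length 2 runs along an edge and back, so every
    closed walk has product 1 ([closed_walk_weight]). Comparing with a reversed
    walk ([walk_reversal]), the product along a walk depends only on its
    endpoints ([walk_weight_endpoints]); fixing a base vertex in each connected
    component, the product along any walk from [x] to its base vertex is then a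
    potential ([exists_potential]). *)

Set Implicit Arguments.
Unset Strict Implicit.
Unset Printing Implicit Defensive.

Import Order.TTheory GRing.Theory Num.Theory.
Local Open Scope ring_scope.

(** Cutting a sequence after both occurrences of a repeated item; for a walk,
    the middle piece is a closed walk from [z] to itself. *)
Lemma not_uniq_split (T : eqType) (s : seq T) :
  ~~ uniq s ->
  exists z s1 s2 s3, s = rcons s1 z ++ rcons s2 z ++ s3.
Proof.
elim: s => //= x s IHs; rewrite negb_and negbK.
case: (boolP (x \in s)) => [/path.splitP[s2 s3] _|_ /= /IHs[z [s1 [s2 [s3 ->]]]]].
  by exists x, [::], s2, s3.
by exists z, (x :: s1), s2, s3.
Qed.

Section WalkWeight.

Variables (K : fieldType) (V : finType) (e : rel V) (m : V -> V -> K).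

Fixpoint walk_weight (x : V) (p : seq V) : K :=
  if p is y :: p' then m x y * walk_weight y p' else 1.

Lemma walk_weight_cat x p q :
  walk_weight x (p ++ q) = walk_weight x p * walk_weight (last x p) q.
Proof. by elim: p x => [|y p IHp] x /=; rewrite ?mul1r // IHp mulrA. Qed.

(** In a duplicate-free sequence [next_at], which searches by value, returns the
    item in the following position. The return vertex [y0] is kept apart from the
    head [y] because the head changes in the induction while [y0] does not. *)
Lemma prod_next_at y0 y p : uniq (y :: p) ->
  \prod_(v <- y :: p) m v (next_at v y0 y p) = walk_weight y (rcons p y0).
Proof.
elim: p y => [|z p IHp] y; first by rewrite big_seq1 /= eqxx mulr1.
rewrite cons_uniq => /andP[y_notin uniq_zp].
rewrite big_cons [rcons _ _]/= [RHS]/= -IHp //= eqxx; congr (_ * _).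
apply: eq_big_seq => v v_in; rewrite ifN //.
by apply: contraNneq y_notin => <-.
Qed.

Lemma prod_next x p : uniq (x :: p) ->
  \prod_(v <- x :: p) m v (next (x :: p) v) = walk_weight x (rcons p x).
Proof. exact: prod_next_at. Qed.

Lemma walk_weight_potential (d : V -> K) x p :
    (forall v, d v != 0) -> (forall v w, e v w -> m v w = d v / d w) ->
  path e x p -> walk_weight x p = d x / d (last x p).
Proof.
move=> d_neq0 m_d; elim: p x => [|y p IHp] x /=; first by rewrite divff.
by case/andP=> /m_d-> /IHp->; rewrite mulrA divfK.
Qed.

Lemma ucycle_potential (d : V -> K) c :
    (forall v, d v != 0) -> (forall v w, e v w -> m v w = d v / d w) ->
  ucycle e c -> \prod_(v <- c) m v (next c v) = 1.
Proof.
move=> d_neq0 m_d /andP[]; case: c => [|x p]; first by rewrite big_nil.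
move=> cycle_c /prod_next->.
by rewrite (walk_weight_potential d_neq0 m_d) // last_rcons divff.
Qed.

Hypothesis e_irr : irreflexive e.
Hypothesis e_sym : symmetric e.
Hypothesis m_inv : forall x y, e x y -> m x y * m y x = 1.

Lemma walk_reversal x p : path e x p ->
  exists q, [/\ path e (last x p) q, last (last x p) q = x
               & walk_weight x p * walk_weight (last x p) q = 1].
Proof.
elim: p x => [|y p IHp] x /=; first by exists [::]; rewrite /= mulr1.
case/andP=> e_xy /IHp[q [path_q last_q weight_q]].
exists (rcons q x); split; rewrite ?last_rcons //.
  by rewrite rcons_path path_q last_q e_sym.
rewrite -cats1 walk_weight_cat last_q /= mulr1 -mulrA.
by rewrite [walk_weight y p * _]mulrA weight_q mul1r m_inv.
Qed.

Hypothesis cycle_weight : forall c, (3 <= size c)%N -> ucycle e c ->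
  \prod_(v <- c) m v (next c v) = 1.

(** Cutting at a repeated vertex gives two shorter closed walks, so only simple
    cycles and the degenerate lengths 0, 1 and 2 remain. Repetitions are looked
    for in [p] rather than in [x :: p], because a nonempty closed walk always
    repeats [x] at its end. *)
Lemma closed_walk_weight x p :
  path e x p -> last x p = x -> walk_weight x p = 1.
Proof.
have [n] := ubnP (size p); elim: n x p => // n IHn x p lt_p path_p last_p.
have [uniq_p|/not_uniq_split[z [p1 [p2 [p3 def_p]]]]] := boolP (uniq p).
  case: (lastP p) => // {}p y in path_p last_p uniq_p lt_p *.
  move: last_p; rewrite last_rcons => def_y; subst y.
  move: uniq_p; rewrite rcons_uniq -cons_uniq => uniq_c.
  case: p => [|y [|z p]] in path_p uniq_c lt_p *.
  - by move: path_p; rewrite /= e_irr.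
  - by move: path_p => /= /andP[/m_inv e_xy _]; rewrite mulr1.
  - by rewrite -prod_next // cycle_weight // /ucycle uniq_c andbT.
move: lt_p path_p last_p; rewrite {p}def_p !size_cat !size_rcons.
rewrite !cat_path !last_cat !last_rcons => lt_p /and3P[path1 path2 path3] last3.
rewrite !walk_weight_cat !last_rcons.
rewrite [walk_weight z _]IHn ?last_rcons //; last first.
  by rewrite size_rcons -ltnS (leq_trans _ lt_p) // ltnS addSn ltnS
             addnCA leq_addr.
rewrite mul1r.
have -> : walk_weight z p3 = walk_weight (last x (rcons p1 z)) p3.
  by rewrite last_rcons.
rewrite -walk_weight_cat IHn ?cat_path ?last_cat ?last_rcons ?path1 //.
rewrite size_cat size_rcons -ltnS (leq_trans _ lt_p) //.
by rewrite ltnS ltn_add2l addSn ltnS leq_addl.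
Qed.

(** The first walk followed by a reversal of the second is closed. *)
Lemma walk_weight_endpoints x p q :
    path e x p -> path e x q -> last x p = last x q ->
  walk_weight x p = walk_weight x q.
Proof.
move=> path_p path_q last_pq.
have [r [path_r last_r weight_r]] := walk_reversal path_q.
have r_neq0 : walk_weight (last x q) r != 0.
  by apply: contra_eq_neq weight_r => ->; rewrite mulr0 eq_sym oner_eq0.
apply: (mulIf r_neq0); rewrite weight_r -last_pq -walk_weight_cat.
by apply: closed_walk_weight; rewrite ?cat_path ?last_cat last_pq // path_p.
Qed.

Lemma exists_potential :
  exists2 d : V -> K,
    forall v, d v != 0 & forall v w, e v w -> m v w = d v / d w.
Proof.
have e_csym : connect_sym e by exact: sym_connect_sym.
have walk_to_root x : exists p, path e x p && (last x p == fingraph.root e x).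
  by have /connectP[p path_p ->] := connect_root e x; exists p; rewrite path_p /=.
pose w x := xchoose (walk_to_root x).
have path_w x : path e x (w x) by case/andP: (xchooseP (walk_to_root x)).
have last_w x : last x (w x) = fingraph.root e x.
  by case/andP: (xchooseP (walk_to_root x)) => _ /eqP.
have d_neq0 x : walk_weight x (w x) != 0.
  have [q [_ _ weight_q]] := walk_reversal (path_w x).
  by apply: contra_eq_neq weight_q => ->; rewrite mul0r eq_sym oner_eq0.
exists (fun x => walk_weight x (w x)) => // x y e_xy.
(* The edge from x to y followed by the walk chosen at y is another walk from x
   to the common base vertex. *)
have -> : walk_weight x (w x) = walk_weight x (y :: w y).
  apply: walk_weight_endpoints => //=; first by rewrite e_xy path_w.
  by rewrite !last_w; apply/(fingraph.rootP e_csym)/connect1.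
by rewrite /= mulfK.
Qed.

End WalkWeight.

Lemma symmetrizableP (l : nat) (A : 'M[int]_l) :
  symmetrizable A <->
  exists2 d : 'I_l -> rat,
    forall i, d i != 0 & forall i j, d i * (A i j)%:Q = d j * (A j i)%:Q.
Proof.
split=> [[d d_neq0 /= /matrixP symm]|[d d_neq0 symm]].
  exists (d 0) => // i j.
  by have := symm j i; rewrite mxE !mul_diag_mx !mxE.
exists (\row_i d i) => [i|/=]; first by rewrite mxE.
by apply/matrixP=> i j; rewrite mxE !mul_diag_mx !mxE.
Qed.

Theorem theorem2p4 (l : nat) (A : 'M[int]_l) (hA : generalized_Cartan A) :
  symmetrizable A <->
  (forall c : seq 'I_l,
     is_cycle (Dynkin_diagram A) c -> balanced (Dynkin_diagram A) c).
Proof.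
case: hA => _ _ A_eq0; set D := Dynkin_diagram A.
have e_sym : symmetric (edge D).
  move=> i j; rewrite /= eq_sym; congr (_ && ~~ _).
  by apply/eqP/eqP; apply: A_eq0.
have edge_neq0 i j : edge D i j -> (A i j)%:Q != 0.
  by case/andP=> _; rewrite intr_eq0.
split=> [/symmetrizableP[d d_neq0 symm] c [_ cycle_c]|cycles_balanced].
  apply: (ucycle_potential d_neq0 _ cycle_c) => i j e_ij.
  by apply/eqP; rewrite eqr_div ?edge_neq0 // mulrC -symm.
have e_irr : irreflexive (edge D) by move=> i; rewrite /= eqxx.
have mult_inv i j : edge D i j -> mult D i j * mult D j i = 1.
  move=> e_ij; have e_ji : edge D j i by rewrite e_sym.
  by rewrite /mult /= mulrA divfK ?divff ?edge_neq0.
have [c size_c cycle_c|d d_neq0 mult_d] :=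
  exists_potential e_irr e_sym mult_inv.
  exact: cycles_balanced.
apply/symmetrizableP; exists d => // i j.
have [->//|neq_ij] := eqVneq i j.
have [A_ij|A_ij] := eqVneq (A i j) 0; first by rewrite A_ij A_eq0 ?mulr0.
have e_ij : edge D i j by rewrite /= neq_ij A_ij.
have /eqP := mult_d i j e_ij.
by rewrite eqr_div ?edge_neq0 // => /eqP <-; rewrite mulrC.
Qed.
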